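(* Let $A$ be a real $N\times N$ matrix with $\rho(|A|)<1$, let $L\ge1$, and let $\mathcal{B}$ be a finite family of subsets of $\{1,\dots,N\}$ such that (1) every orbit $\ell$ of $A$ with $|\ell|<L$ is covered by some $B\in\mathcal{B}$, and (2) $B,B'\in\mathcal{B}$ implies $B\cap B'\in\mathcal{B}$. With block weights $w_B$ and $Z_{\mathcal{B}}=\prod_{B\in\mathcal{B}}\big(\det(I-A_B)^{-1}\big)^{w_B}$ as in the context, $$Z_{\mathcal{B}}=\prod_{\ell\in\mathcal{L}_{\mathcal{B}}}(1-A^\ell)^{-1},$$ where $\mathcal{L}_{\mathcal{B}}=\bigcup_{B\in\mathcal{B}}\mathcal{L}_B$ and $\mathcal{L}_B$ is the set of orbits of $A$ covered by $B$.
   Context: $|A|$ is the entrywise absolute value and $\rho$ the spectral radius. Walks of $A$: sequences $(w_0,\dots,w_m)$ of indices in $\{1,\dots,N\}$ with $A_{w_tw_{t+1}}\neq0$ for all $t$; closed if $m\ge1$ and $w_0=w_m$; a closed walk is primitive if it is not an $k$-fold concatenation ($k\ge2$) of a shorter closed walk. An orbit is an equivalence class of closed primitive walks under cyclic shifts; its length $|\ell|$ is the length of a representative; $A^\ell=\prod_{t}A_{w_tw_{t+1}}$ over the steps of a representative. An orbit is covered by $B$ if all of its vertices lie in $B$. $A_B$ is the principal $|B|\times|B|$ submatrix of $A$ on $B$ (with $\det(I-A_\emptyset)=1$). Block weights: $w_B=1$ if $B$ is maximal in $\mathcal{B}$ (not properly contained in another member), and otherwise $w_B=1-\sum_{B'\in\mathcal{B},\,B'\supsetneq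 B}w_{B'}$ (defined recursively downward by inclusion). *)

(* Defs.v *)
From HB Require Import structures.
From mathcomp Require Import all_boot all_order all_algebra.
From mathcomp Require Import complex.
From mathcomp Require Import all_classical all_reals topology normedtype sequences.
Set Implicit Arguments. Unset Strict Implicit. Unset Printing Implicit Defensive.
Import Order.TTheory GRing.Theory Num.Theory.
Local Open Scope ring_scope.

Section Defs.
Variables (R : realType) (N : nat).
Implicit Types (A : 'M[R]_N) (s : seq 'I_N) (B : {set 'I_N}).

Definition mx_abs A : 'M[R]_N := map_mx (fun x => `|x|) A.

Definition spectral_radius_lt1 (M : 'M[R]_N) : Prop :=
  forall z : R[i], root (char_poly (map_mx (fun x => (x%:C)%C) M)) z -> `|z| < 1.

(* A closed walk (w_0,...,w_{m-1},w_m = w_0), m >= 1, is represented by the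
   cyclic sequence s = [:: w_0; ...; w_{m-1}] : its steps are w_t -> w_{t+1}
   (indices mod m). *)
Definition closed_walk A s : bool :=
  (0 < size s)%N && cycle (fun i j => A i j != 0) s.

Definition primitive_walk A s : Prop :=
  closed_walk A s /\
  ~ (exists (u : seq 'I_N) (k : nat),
        (1 < k)%N /\ closed_walk A u /\ s = flatten (nseq k u)).

Definition walk_weight A s : R :=
  \prod_(p <- zip s (rot 1 s)) A p.1 p.2.

Definition orbit_of (m : nat) (t : m.-tuple 'I_N) : {set m.-tuple 'I_N} :=
  [set t' : m.-tuple 'I_N | [exists k : 'I_m.+1, val t' == rot k (val t)]].

Definition orbits A (m : nat) : {set {set m.-tuple 'I_N}} :=
  [set orbit_of t | t in [set t : m.-tuple 'I_N | `[< primitive_walk A (val t) >] ]].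

Definition orbit_weight A (m : nat) (O : {set m.-tuple 'I_N}) : R :=
  if [pick t in O] is Some t then walk_weight A (val t) else 0.

Definition covered (m : nat) (O : {set m.-tuple 'I_N}) B : bool :=
  [forall t in O, all (fun i => i \in B) (val t)].

Definition principal_submx A B : 'M[R]_#|B| :=
  \matrix_(i < #|B|, j < #|B|) A (enum_val i) (enum_val j).

(* block weights, by downward recursion along inclusion: the fuel #|~: B|
   bounds the length of any chain of proper supersets of B. *)
Fixpoint wB_rec (fam : {set {set 'I_N}}) (n : nat) B : int :=
  match n with
  | 0 => 1
  | n'.+1 => 1 - \sum_(B' in fam | B \proper B') wB_rec fam n' B'
  end.
Definition block_weight (fam : {set {set 'I_N}}) B : int := wB_rec fam #|~: B| B.

Definition Z_fam A (fam : {set {set 'I_N}}) : R :=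
  \prod_(B in fam) ((\det (1%:M - principal_submx A B))^-1) ^ (block_weight fam B).

Definition orbit_partial_prod A (fam : {set {set 'I_N}}) (n : nat) : R :=
  \prod_(m < n.+1)
     \prod_(O in orbits A m | [exists B in fam, covered O B])
        (1 - orbit_weight A O)^-1.

End Defs.

(* Main.v *)
Require Import Defs.
From HB Require Import structures.
From mathcomp Require Import all_boot all_order all_algebra.
From mathcomp Require Import complex spectral.
From mathcomp Require Import all_classical all_reals topology normedtype sequences exp.
Import Order.TTheory GRing.Theory Num.Theory numFieldNormedType.Exports.
Local Open Scope ring_scope.

(** The formal identity behind the theorem is
    [det (I - t A) = \prod_l (1 - t^|l| A^l)], as power series in [t]: both sides
    have constant term 1 and logarithmic derivative [- \sum_j tr(A^j) t^(j-1)],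
    because [tr(A^j)] sums the weights of the closed walks of length [j], each of
    which is a power of a unique primitive one.  The trace side is read off the
    eigenvalues of [A].  Since [rho(|A|) < 1], the closed walks of length [m]
    have total absolute weight [O(r^m)] with [r < 1], so the coefficients of the
    partial products are dominated by those of [\prod_l (1 + t^|l| |A^l|)], which
    are summable with a geometric weight; hence the identity survives at [t = 1].
    Applied to [A] restricted to each block [B], this gives
    [det(I - A_B)^-1 = \prod_(l covered by B) (1 - A^l)^-1].  Finally, an orbit [l]
    covered by the family appears in [Z] with exponent the sum of [w_B] over the
    blocks [B] covering [l]; these are the blocks containing the smallest such
    block, so the recursion defining [w] makes the exponent 1. *)

(** * Logarithmic derivatives of polynomials modulo powers of X *)

Section LogDerivative.
Variable F : numDomainType.
Implicit Types (p q : {poly F}) (c d : nat -> F) (n : nat).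

(** Congruence modulo ['X^(n.+1)]: coefficient [n] is included. *)
Definition eqmodX n p q := forall k, (k <= n)%N -> p`_k = q`_k.

Lemma eqmodX_refl n p : eqmodX n p p.
Proof. by []. Qed.
#[local] Hint Resolve eqmodX_refl : core.

Lemma eqmodX_trans n q p p' : eqmodX n p q -> eqmodX n q p' -> eqmodX n p p'.
Proof. by move=> h1 h2 k kn; rewrite h1// h2. Qed.

Lemma eqmodX_sym n p q : eqmodX n p q -> eqmodX n q p.
Proof. by move=> h k kn; rewrite h. Qed.

Lemma eqmodXM n p p' q q' :
  eqmodX n p p' -> eqmodX n q q' -> eqmodX n (p * q) (p' * q').
Proof.
move=> pp qq k kn; rewrite !coefM; apply: eq_bigr => i _.
rewrite pp ?qq//; last by rewrite (leq_trans _ kn) // -ltnS.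
by rewrite (leq_trans (leq_subr _ _)).
Qed.

Lemma eqmodXD n p p' q q' :
  eqmodX n p p' -> eqmodX n q q' -> eqmodX n (p + q) (p' + q').
Proof. by move=> pp qq k kn; rewrite !coefD pp// qq. Qed.

Definition xderiv p := 'X * p^`().

Lemma coef_xderiv p k : (xderiv p)`_k = p`_k *+ k.
Proof. by rewrite /xderiv coefXM coef_deriv; case: k. Qed.

Lemma xderivM p q : xderiv (p * q) = xderiv p * q + p * xderiv q.
Proof. by rewrite /xderiv derivM mulrDr mulrA mulrCA. Qed.

(** Strong induction on the index. In coefficient [k.+1] of the hypothesis the inner terms agree by
    induction and those of index 0 vanish; what is left is [k.+1] times the two unknown
    coefficients, and characteristic 0 allows division. *)
Lemma eqmodX_xderiv n p q : p`_0 = 1 -> q`_0 = 1 ->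
  eqmodX n (xderiv p * q) (xderiv q * p) -> eqmodX n p q.
Proof.
move=> p0 q0 h; elim/ltn_ind => -[|k] IH kn; first by rewrite p0 q0.
have := h _ kn; rewrite !coefM !(big_ord_recr k.+1) /= subnn p0 q0 !mulr1 !coef_xderiv.
set s := \sum_(_ < _) _; set t := \sum_(_ < _) _.
have -> : s = t.
  apply: eq_bigr => i _; rewrite !coef_xderiv.
  have ik := ltn_ord i.
  have ikn : (i <= n)%N := leq_trans (ltnW ik) kn.
  rewrite (IH i ik ikn); have [i0|i0] := posnP i; first by rewrite i0 !mulr0n !mul0r.
  have sk : (k.+1 - i < k.+1)%N by rewrite ltn_subrL i0.
  by rewrite (IH _ sk (leq_trans (ltnW sk) kn)).
by move/addrI/eqP; rewrite -subr_eq0 -mulrnBl mulrn_eq0 /= subr_eq0 => /eqP.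
Qed.

(* [- \sum_(j >= 1) c j * 'X^j] is the logarithmic derivative ['X * p' / p]. *)
Definition has_logderiv n p c :=
  p`_0 = 1 /\
  eqmodX n (xderiv p) (- \poly_(j < n.+1) (if j == 0%N then 0 else c j) * p).

Lemma has_logderiv1 n : has_logderiv n 1 (fun=> 0).
Proof.
split=> [|k kn]; first by rewrite coef1.
rewrite coef_xderiv coef1 mulr1 coefN coef_poly if_same if_same oppr0.
by case: k kn => [|k] _; rewrite ?mul0rn ?mulr0n.
Qed.

Lemma has_logderivM n p q c d : has_logderiv n p c -> has_logderiv n q d ->
  has_logderiv n (p * q) (fun j => c j + d j).
Proof.
move=> [p0 hp] [q0 hq]; split.
  by rewrite coefM big_ord1 /= p0 q0 mulr1.
rewrite xderivM.
set T := \poly_(j < _) _.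
have -> : T = \poly_(j < n.+1) (if j == 0%N then 0 else c j)
            + \poly_(j < n.+1) (if j == 0%N then 0 else d j).
  apply/polyP => k; rewrite coefD !coef_poly; case: ifP => _; last by rewrite addr0.
  by case: ifP => _; rewrite ?addr0.
rewrite opprD mulrDl [X in eqmodX _ _ (X + _)]mulrA [X in eqmodX _ _ (_ + X)]mulrCA.
by apply: eqmodXD; apply: eqmodXM.
Qed.

Lemma has_logderiv_prod n (I : Type) (r : seq I) (P : pred I)
    (p : I -> {poly F}) (c : I -> nat -> F) :
  (forall i, P i -> has_logderiv n (p i) (c i)) ->
  has_logderiv n (\prod_(i <- r | P i) p i) (fun j => \sum_(i <- r | P i) c i j).
Proof.
move=> h; elim: r => [|i r IH].
  have -> : (fun j => \sum_(i <- [::] | P i) c i j) = fun=> 0.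
    by apply: boolp.funext => j; rewrite big_nil.
  by rewrite big_nil; apply: has_logderiv1.
rewrite big_cons.
have -> : (fun j => \sum_(i <- i :: r | P i) c i j) =
   if P i then fun j => c i j + \sum_(i <- r | P i) c i j else fun j => \sum_(i <- r | P i) c i j.
  by apply: boolp.funext => j; rewrite big_cons; case: ifP.
by case: ifP => // Pi; apply: has_logderivM => //; apply: h.
Qed.

(** The series is [- \sum_(q >= 1) m a^q X^(q m)]. Multiplied by the factor it telescopes: past
    degree [m], the contributions [a ^+ q] and [a * a ^+ (q - 1)] cancel. *)
Lemma has_logderiv_factor n (a : F) m : (0 < m)%N ->
  has_logderiv n (1 - a *: 'X^m)
    (fun j => if (m %| j)%N then a ^+ (j %/ m) *+ m else 0).
Proof.
move=> m0; split.
  by rewrite coefB coef1 coefZ coefXn /= eq_sym (gtn_eqF m0) mulr0 subr0.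
move=> k kn; rewrite coef_xderiv coefB coef1 coefZ coefXn.
rewrite mulrBr mulr1 -scalerAr coefB coefZ coefMXn !coefN !coef_poly ltnS kn.
have [->|k0] := eqVneq k 0%N.
  by rewrite mulr0n m0 mulr0 subr0 oppr0.
rewrite sub0r ltnS (leq_trans (leq_subr _ _) kn).
have [km|mk] := ltnP k m.
  by rewrite ltn_eqF// gtnNdvd ?lt0n//= !(mulr0, subr0, oppr0, mul0rn, addr0).
rewrite subn_eq0; have [->|nkm] := eqVneq k m.
  by rewrite leqnn dvdnn divnn m0 expr1 !(mulr1, oppr0, mulr0, subr0) mulNrn.
have mk' : (m < k)%N by rewrite ltn_neqAle eq_sym nkm.
rewrite leqNgt mk' /= !(mulr0, oppr0, mul0rn) dvdn_subl//.
case: ifP => [/dvdnP[q kq]|_]; last by rewrite !(mulr0, oppr0, subr0).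
rewrite {}kq in k0 mk nkm mk' kn *.
have -> : (q * m - m = (q - 1) * m)%N by rewrite mulnBl mul1n.
rewrite !mulnK//.
case: q k0 {mk nkm mk' kn} => [|q] k0; first by rewrite mul0n in k0.
by rewrite subn1 /= mulrN opprK mulrnAr -exprS addNr.
Qed.

(** After cross-multiplication, [xderiv p * q] and [xderiv q * p] are both congruent to the common
    series times [p * q]. *)
Lemma has_logderiv_inj n p q c d : has_logderiv n p c -> has_logderiv n q d ->
  (forall j, (0 < j <= n)%N -> c j = d j) -> eqmodX n p q.
Proof.
move=> [p0 hp] [q0 hq] cd; apply: eqmodX_xderiv => //.
have E : - \poly_(j < n.+1) (if j == 0%N then 0 else c j)
       = - \poly_(j < n.+1) (if j == 0%N then 0 else d j).
  congr (- _); apply/polyP => k; rewrite !coef_poly ltnS; case: leqP => // kn.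
  by case: eqVneq => // k0; rewrite cd// lt0n k0.
apply: (eqmodX_trans _ (- \poly_(j < n.+1) (if j == 0%N then 0 else c j) * p * q)).
  exact: eqmodXM.
rewrite mulrAC E; apply: eqmodXM => //; exact: eqmodX_sym.
Qed.

End LogDerivative.

(** * Eigenvalues and determinants *)

Lemma trig_mx_mul (R : comNzRingType) n (S T : 'M[R]_n) :
  is_trig_mx S -> is_trig_mx T ->
  is_trig_mx (S *m T) /\ forall i, (S *m T) i i = S i i * T i i.
Proof.
move=> /is_trig_mxP S0 /is_trig_mxP T0; split=> [|i].
  apply/is_trig_mxP => i j ij; rewrite mxE big1// => k _.
  have [ik|ki] := ltnP i k; first by rewrite S0// mul0r.
  by rewrite T0 ?mulr0// (leq_ltn_trans ki).
rewrite mxE (bigD1 i)//= big1 ?addr0// => k ki.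
have [ik|] := ltnP i k; first by rewrite S0// mul0r.
move: ki; rewrite -val_eqE leq_eqVlt => /negbTE -> /= ki.
by rewrite T0// mulr0.
Qed.

Lemma trig_mx_exp (R : comNzRingType) n (T : 'M[R]_n) j : is_trig_mx T ->
  is_trig_mx (T ^+ j) /\ forall i, (T ^+ j) i i = T i i ^+ j.
Proof.
move=> Ttrig; elim: j => [|j [IH1 IH2]].
  by rewrite expr0; split=> [|i]; rewrite ?mxE ?eqxx ?scalar_mx_is_trig.
have [h1 h2] := trig_mx_mul _ _ _ _ Ttrig IH1.
by rewrite exprS; split=> // i; rewrite h2 IH2 exprS.
Qed.

(** By Schur triangularisation, the characteristic polynomial and the traces of all powers are read
    off the same diagonal. *)
Lemma char_poly_roots (C : numClosedFieldType) n (M : 'M[C]_n) :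
  exists s : seq C, char_poly M = \prod_(x <- s) ('X - x%:P) /\
    forall j, \tr (M ^+ j) = \sum_(x <- s) x ^+ j.
Proof.
case: (posnP n) => [n0|n0].
  subst n; exists [::]; split=> [|j]; first by rewrite big_nil /char_poly det_mx00.
  by rewrite big_nil /mxtrace big_ord0.
have [P /unitarymx_unit Pu] := @Schur C n M n0.
rewrite /similar_to/= conjumx//; set T := P *m M *m invmx P => Ttrig.
exists [seq T i i | i <- enum 'I_n]; split=> [|j].
  rewrite big_map big_enum -char_poly_trig//.
  have PP : map_mx polyC P *m map_mx polyC (invmx P) = 1%:M.
    by rewrite -map_mxM mulmxV// map_mx1.
  have -> : char_poly T = \det (map_mx polyC P *m char_poly_mx M *m map_mx polyC (invmx P)).
    rewrite /char_poly /char_poly_mx mulmxBr mulmxBl -!map_mxM/=.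
    by rewrite -mulmxA mul_scalar_mx -scalemxAr PP scalemx1.
  by rewrite !det_mulmx mulrAC -det_mulmx PP det1 mul1r.
rewrite big_map big_enum/=.
have -> : \tr (M ^+ j) = \tr (T ^+ j).
  have -> : T ^+ j = P *m M ^+ j *m invmx P.
    elim: j => [|j IH]; first by rewrite !expr0 mulmx1 mulmxV.
    by rewrite exprS IH /T -!mulmxE !mulmxA mulmxKV// exprS -mulmxE !mulmxA.
  by rewrite mxtrace_mulC mulmxA mulVmx// mul1mx.
by apply: eq_bigr => i _; rewrite (trig_mx_exp _ _ _ _ Ttrig).2.
Qed.

(** Sylvester's identity, from two block triangular factorisations of one block matrix. *)
Lemma det_sub1_mulmx (R : comNzRingType) m n (X : 'M[R]_(m, n)) (Y : 'M[R]_(n, m)) :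
  \det (1%:M - X *m Y) = \det (1%:M - Y *m X).
Proof.
pose B := block_mx 1%:M X Y (1%:M : 'M[R]_n).
have E1 : B = block_mx 1%:M 0 Y 1%:M *m block_mx 1%:M X 0 (1%:M - Y *m X).
  by rewrite mulmx_block !(mul1mx, mul0mx, mulmx1, mulmx0, addr0) addrC subrK.
have E2 : B = block_mx (1%:M - X *m Y) X 0 1%:M *m block_mx 1%:M 0 Y 1%:M.
  by rewrite mulmx_block !(mul1mx, mul0mx, mulmx1, mulmx0, addr0, add0r) subrK.
transitivity (\det B).
  by rewrite E2 det_mulmx det_ublock det_lblock !det1 !mulr1.
by rewrite E1 det_mulmx det_ublock det_lblock !det1 !mul1r.
Qed.

(** * Powers and rotations of words *)

Section Words.
Variable T : eqType.
Implicit Types (u v w s : seq T).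
Local Notation pw k u := (flatten (nseq k u)).

Lemma size_power k u : size (pw k u) = (k * size u)%N.
Proof. by rewrite size_flatten /shape map_nseq sumn_nseq mulnC. Qed.

Lemma power_cat_conj k v w : pw k (v ++ w) ++ v = v ++ pw k (w ++ v).
Proof.
by elim: k => [|k IH] /=; [rewrite cats0 | rewrite -!catA IH !catA].
Qed.

Lemma rot_power r k u : (r <= size u)%N -> rot r (pw k u) = pw k (rot r u).
Proof.
move=> ru; rewrite -(cat_take_drop r u).
move: (take r u) (drop r u) (size_takel ru) => v w <-.
rewrite rot_size_cat; case: k => [|k]; first by rewrite /rot.
by rewrite /= -!catA rot_size_cat -!catA power_cat_conj.
Qed.

(** For [k > 0], commutation makes [u] a prefix of [v]; once it is peeled off, the remainder still
    commutes with [u]. *)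
Lemma power_of_commute k u v : size v = (k * size u)%N ->
  u ++ v = v ++ u -> v = pw k u.
Proof.
elim: k v => [|k IH] v; first by rewrite mul0n => /eqP/nilP ->.
rewrite mulSn => sv E.
have vE : v = u ++ drop (size u) v.
  have uv : take (size u) v = u.
    have /(congr1 (take (size u))) := E.
    rewrite take_size_cat// takel_cat ?sv ?leq_addr//.
  by rewrite -{1}uv cat_take_drop.
rewrite vE /=; congr (_ ++ _); apply: IH; first by rewrite size_drop sv addKn.
by move: E; rewrite {1 2}vE -catA => /eqP; rewrite eqseq_cat// eqxx => /eqP.
Qed.

(** Invariance under [rot m] says that the first [m] letters commute with the rest. *)
Lemma power_of_rot k m s : size s = (k * m)%N -> (0 < k)%N -> rot m s = s ->
  s = pw k (take m s).
Proof.
case: k => // k ss _ E.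
have sm : size (take m s) = m by rewrite size_takel// ss mulSn leq_addr.
rewrite /= -{1}(cat_take_drop m s); congr (_ ++ _).
apply: power_of_commute; first by rewrite sm size_drop ss mulSn addKn.
by rewrite cat_take_drop -{1}E.
Qed.

Lemma power_inj k u v : (0 < k)%N -> size u = size v -> pw k u = pw k v -> u = v.
Proof.
case: k => // k _ uv /= /(congr1 (take (size u))).
by rewrite take_size_cat// uv take_size_cat.
Qed.

End Words.

Lemma zip_rot1 (S T : Type) (s : seq S) (t : seq T) : size s = size t ->
  zip (rot 1 s) (rot 1 t) = rot 1 (zip s t).
Proof.
by case: s t => [|x s] [|y t]//= [st]; rewrite !rot1_cons -!cats1 zip_cat.
Qed.

(** Reduce [k] modulo the order: among the iterates of index below the order, only the one of index
    0 fixes [x]. *)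
Lemma dvdn_order (T : finType) (f : T -> T) x k : injective f ->
  (order f x %| k)%N = (iter k f x == x).
Proof.
move=> fI; apply/idP/eqP => [/dvdnP[q ->]|].
  by elim: q => // q IH; rewrite mulSn addnC iterD iter_order.
rewrite {1}(divn_eq k (order f x)) addnC iterD.
have -> : iter (k %/ order f x * order f x) f x = x.
  by elim: (k %/ _)%N => // q IH; rewrite mulSn addnC iterD iter_order.
move=> E; have lt := ltn_pmod k (order_gt0 f x).
by rewrite /dvdn -(findex_iter lt) E findex0.
Qed.

Lemma order_inj_morph (S T : finType) (f : S -> S) (g : T -> T) (h : S -> T) x :
  injective f -> injective g -> injective h ->
  (forall y, h (f y) = g (h y)) -> order g (h x) = order f x.
Proof.
move=> fI gI hI hfg.
have E n : iter n g (h x) = h (iter n f x).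
  by elim: n => //= n ->; rewrite hfg.
apply/eqP; rewrite eqn_dvd (dvdn_order _ _ _ _ gI) (dvdn_order _ _ _ _ fI) E.
by rewrite iter_order// eqxx -(inj_eq hI) -E iter_order ?eqxx.
Qed.

(** * Cyclic shifts of tuples and least periods *)

Section Rotation.
Context {T : finType}.

(** On a finite type, this makes [order rot1t t] the least period of the cyclic word [t]. *)
Definition rot1t {m} (t : m.-tuple T) : m.-tuple T := [tuple of rot 1 t].
Definition powt k {m} (u : m.-tuple T) : (k * m).-tuple T :=
  @Tuple (k * m) T (flatten (nseq k (val u)))
    (introT eqP (etrans (size_power _ k u) (congr1 (muln k) (size_tuple u)))).

Lemma rot1t_inj m : injective (@rot1t m).
Proof. by move=> s t /(congr1 val) /rot_inj /val_inj. Qed.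

Lemma val_iter_rot1t m (t : m.-tuple T) k : (k <= m)%N ->
  val (iter k (@rot1t m) t) = rot k t.
Proof.
elim: k => [|k IH] km; first by rewrite rot0.
by rewrite [RHS]rotS ?size_tuple// -IH// ltnW.
Qed.

Lemma iter_rot1t m (t : m.-tuple T) : iter m (@rot1t m) t = t.
Proof.
by apply: val_inj; rewrite val_iter_rot1t// -{1}(size_tuple t) rot_size.
Qed.

Lemma order_rot1t_dvd m (t : m.-tuple T) : (order (@rot1t m) t %| m)%N.
Proof. by rewrite (dvdn_order _ _ _ _ (@rot1t_inj m)) iter_rot1t. Qed.

Lemma powt_inj k m : (0 < k)%N -> injective (@powt k m).
Proof.
move=> k0 s t /(congr1 val) /= /power_inj E; apply: val_inj; apply: E => //.
by rewrite !size_tuple.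
Qed.

Lemma order_powt k m (u : m.-tuple T) : (0 < k)%N -> (0 < m)%N ->
  order (@rot1t (k * m)) (powt k u) = order (@rot1t m) u.
Proof.
move=> k0 m0; apply: order_inj_morph; do ?exact: rot1t_inj.
  exact: powt_inj.
by move=> y; apply: val_inj => /=; rewrite rot_power// size_tuple.
Qed.

(** A word of least period [m] is the power of its first [m] letters, whose least period is still
    [m]. Together with [powt_inj], this says that a word is a power of a unique primitive one. *)
Lemma imset_powt k m : (0 < k)%N -> (0 < m)%N ->
  [set t | order (@rot1t (k * m)) t == m] =
  @powt k m @: [set u | order (@rot1t m) u == m].
Proof.
move=> k0 m0; apply/setP => t; rewrite inE; apply/eqP/imsetP => [tm|[u]]; last first.
  by rewrite inE => /eqP um ->; rewrite order_powt.
have mkm : (m <= k * m)%N by rewrite leq_pmull.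
have st : size (take m t) == m by rewrite size_takel// size_tuple.
have E : t = powt k (Tuple st).
  apply: val_inj => /=; apply: power_of_rot => //; first by rewrite size_tuple.
  by have := iter_order (@rot1t_inj _) t; rewrite tm -val_iter_rot1t// => ->.
by exists (Tuple st) => //; rewrite inE -(order_powt k _ _ k0 m0) -E tm.
Qed.
End Rotation.

(** * Weights of closed walks, and primitivity *)

Section WalkWeight.
Context {R : realType} {N : nat}.
Implicit Types (A : 'M[R]_N) (s u : seq 'I_N).

Lemma walk_weight_rot1 A s : walk_weight A (rot 1 s) = walk_weight A s.
Proof.
rewrite /walk_weight zip_rot1 ?size_rot//.
by apply: perm_big; rewrite perm_rot.
Qed.

Lemma walk_weight_rot A k s : walk_weight A (rot k s) = walk_weight A s.
Proof.
have [sk|ks] := leqP (size s) k; first by rewrite rot_oversize.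
elim: k ks => [|k IH] ks; first by rewrite rot0.
by rewrite rotS 1?ltnW// walk_weight_rot1 IH// ltnW.
Qed.

Lemma walk_weight_power A k u :
  walk_weight A (flatten (nseq k u)) = walk_weight A u ^+ k.
Proof.
have [->|u0] := eqVneq u [::].
  have -> : flatten (nseq k [::]) = [::] :> seq 'I_N by elim: k.
  by rewrite /walk_weight big_nil expr1n.
rewrite /walk_weight rot_power ?lt0n ?size_eq0//.
elim: k => [|k IH] /=; first by rewrite big_nil expr0.
by rewrite zip_cat ?size_rot// big_cat /= IH exprS.
Qed.

Lemma path_weight_neq0 A x s y :
  path (fun i j => A i j != 0) x (rcons s y) =
  (\prod_(p <- zip (x :: s) (rcons s y)) A p.1 p.2 != 0).
Proof.
elim: s x => [|z s IH] x /=; first by rewrite big_seq1 andbT.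
by rewrite big_cons mulf_eq0 negb_or IH.
Qed.

(** A product in a field vanishes only if a factor does. Sums of weights over closed walks may
    therefore run over all tuples. *)
Lemma closed_walkE A s : closed_walk A s = (0 < size s)%N && (walk_weight A s != 0).
Proof.
case: s => //= x s; rewrite /closed_walk /= /walk_weight rot1_cons.
exact: path_weight_neq0.
Qed.

(** The least period [p] divides [m]; if [p < m], the walk is a power of its first [p] vertices,
    which form a closed walk because a power of their weight is nonzero. Conversely, a [k]-fold
    power of [u] has period [size u < m]. *)
Lemma primitive_walkP A m (t : m.-tuple 'I_N) : (0 < m)%N ->
  primitive_walk A (val t) <->
  (walk_weight A (val t) != 0) /\ order (@rot1t _ m) t = m.
Proof.
move=> m0; rewrite /primitive_walk closed_walkE size_tuple m0 /=; split.
  move=> [w0 np]; split=> //.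
  have /dvdnP[k mE] := order_rot1t_dvd m t; set p := order _ _ in mE *.
  have k0 : (0 < k)%N by case: k mE m0 => // -> .
  have [k1|k1] := ltnP 1 k; last first.
    by rewrite [RHS]mE; case: k k0 k1 {mE} => [|[|]]// _ _; rewrite mul1n.
  exfalso; apply: np; exists (take p (val t)), k.
  have tE : val t = flatten (nseq k (take p (val t))).
    apply: power_of_rot => //; first by rewrite size_tuple.
    rewrite -val_iter_rot1t; last by rewrite mE leq_pmull.
    by rewrite iter_order//; apply: rot1t_inj.
  split=> //; split=> //; rewrite closed_walkE.
  have wE : walk_weight A (val t) = walk_weight A (take p (val t)) ^+ k.
    by rewrite [in LHS]tE walk_weight_power.
  move: w0; rewrite wE expf_eq0 k0 /= => ->.
  by rewrite andbT size_take size_tuple; case: ifP => // _; apply: order_gt0.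
move=> [w0 tm]; split=> // -[u [k [k1 [cu tE]]]].
have su : m = (k * size u)%N by rewrite -(size_tuple t) [in LHS]tE size_power.
have u0 : (0 < size u)%N by case/andP: cu.
have k0 : (0 < k)%N by apply: ltnW.
have : (m %| size u)%N.
  rewrite -{1}tm dvdn_order; last exact: rot1t_inj.
  apply/eqP/val_inj; rewrite val_iter_rot1t; last by rewrite su leq_pmull.
  by rewrite tE rot_power// rot_size.
by move/(dvdn_leq u0); rewrite leqNgt su ltn_Pmull.
Qed.

End WalkWeight.

(** * Closed walks, orbits and traces *)

Section Counting.
Context {R : realType} {N : nat}.
Implicit Types (A : 'M[R]_N).

Lemma mem_orbit_of m (t t' : m.-tuple 'I_N) : (0 < m)%N ->
  (t' \in orbit_of t) = fconnect rot1t t t'.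
Proof.
move=> m0; rewrite inE; apply/existsP/idP => [[k /eqP E]|].
  have -> : t' = iter k rot1t t.
    by apply: val_inj; rewrite val_iter_rot1t -1?ltnS.
  exact: fconnect_iter.
move/iter_findex => <-; set k := findex _ _ _.
(* [orbit_of] only allows shifts up to [m], so the index is reduced modulo [m]. *)
have km : (k %% m < m.+1)%N by rewrite ltnS ltnW// ltn_pmod.
exists (Ordinal km); apply/eqP; rewrite /= -val_iter_rot1t; last by rewrite ltnW// ltn_pmod.
congr (val _); rewrite {1}(divn_eq k m) addnC iterD; congr (iter _ _ _).
by elim: (k %/ m)%N => // q IH; rewrite mulSn addnC iterD iter_rot1t.
Qed.

Lemma card_orbit_of m (t : m.-tuple 'I_N) : (0 < m)%N ->
  #|orbit_of t| = order rot1t t.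
Proof.
by move=> m0; rewrite /order; apply: eq_card => t'; rewrite mem_orbit_of.
Qed.

Lemma walk_weight_orbit A m (t t' : m.-tuple 'I_N) : t' \in orbit_of t ->
  walk_weight A (val t') = walk_weight A (val t).
Proof. by rewrite inE => /existsP[k /eqP ->]; rewrite walk_weight_rot. Qed.

Lemma orbit_weight_orbit_of A m (t : m.-tuple 'I_N) :
  orbit_weight A (orbit_of t) = walk_weight A (val t).
Proof.
rewrite /orbit_weight; case: pickP => [t' /walk_weight_orbit->//|/(_ t)].
by rewrite inE => /existsP[]; exists ord0; rewrite rot0.
Qed.

Lemma orbits_gt0 A m (O : {set m.-tuple 'I_N}) : O \in orbits A m -> (0 < m)%N.
Proof.
case/imsetP=> t; rewrite inE => /asboolP[]; rewrite closed_walkE size_tuple.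
by case/andP.
Qed.

(** The primitive walks of length [m] fall into orbits of exactly [m] elements, on which the weight
    is constant; [f 0 = 0] discards the tuples that are not walks. It serves with powers for [f] in
    the traces and with the norm in the estimates. *)
Lemma sum_orbits A m (f : R -> R) : (0 < m)%N -> f 0 = 0 ->
  \sum_(t : m.-tuple 'I_N | order rot1t t == m) f (walk_weight A (val t)) =
  \sum_(O in orbits A m) f (orbit_weight A O) *+ m.
Proof.
move=> m0 f0; rewrite /orbits.
set S := [set t : m.-tuple 'I_N | _].
have SP t : (t \in S) = (walk_weight A (val t) != 0) && (order rot1t t == m).
  rewrite inE; apply/asboolP/andP.
    by move/(primitive_walkP _ _ _ m0) => [-> ->].
  by move=> [w0 /eqP tm]; apply/(primitive_walkP _ _ _ m0).
transitivity (\sum_(t in S) f (walk_weight A (val t))).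
  rewrite big_mkcond [RHS]big_mkcond; apply: eq_bigr => t _; rewrite SP.
  by have [->|_] := eqVneq (walk_weight A (val t)) 0; rewrite ?f0 ?if_same.
rewrite (partition_big_imset (@orbit_of N m)) /=; apply: eq_bigr => O /imsetP[t0 t0S ->].
rewrite orbit_weight_orbit_of.
have [w0 /eqP ot] : walk_weight A (val t0) != 0 /\ order rot1t t0 == m.
  by apply/andP; rewrite -SP.
have cE : #|orbit_of t0| = m by rewrite card_orbit_of.
rewrite -[X in _ *+ X]cE -sumr_const; apply: eq_big => [t|t].
  apply/andP/idP => [[tS /eqP <-]|tt0].
    by rewrite mem_orbit_of.
  have tt : orbit_of t = orbit_of t0.
    apply/setP => t'; rewrite !mem_orbit_of//; apply/esym.
    apply: same_connect; first exact/fconnect_sym/rot1t_inj.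
    by rewrite -mem_orbit_of.
  by rewrite SP (walk_weight_orbit _ _ _ _ tt0) w0 -card_orbit_of// tt card_orbit_of// ot eqxx.
move=> /andP[_ /eqP tt]; congr f; apply: walk_weight_orbit.
by rewrite -tt mem_orbit_of.
Qed.

Lemma sum_period (A : 'M[R]_N) j m : (0 < j)%N -> (m %| j)%N ->
  \sum_(t : j.-tuple 'I_N | order rot1t t == m) walk_weight A (val t) =
  \sum_(u : m.-tuple 'I_N | order rot1t u == m) walk_weight A (val u) ^+ (j %/ m).
Proof.
move=> j0 /dvdnP[k jE]; subst j.
have [k0 m0] : (0 < k)%N /\ (0 < m)%N by apply/andP; rewrite -muln_gt0.
have := @imset_powt 'I_N k m k0 m0; set S := finset _; set D := finset _ => SE.
transitivity (\sum_(t in S) walk_weight A (val t)).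
  by apply: eq_bigl => t; rewrite inE.
rewrite SE big_imset /=; last by move=> ? ? _ _; apply: powt_inj.
apply: eq_big => [u|u _]; first by rewrite inE.
by rewrite mulnK// walk_weight_power.
Qed.

(** Closed walks are sorted by least period [m], a divisor of [j]; each is the power [j %/ m] of a
    primitive walk of length [m]. *)
Lemma sum_walk_weight A n j : (0 < j <= n)%N ->
  \sum_(t : j.-tuple 'I_N) walk_weight A (val t) =
  \sum_(m < n.+1) \sum_(O in orbits A m)
    if (m %| j)%N then orbit_weight A O ^+ (j %/ m) *+ m else 0.
Proof.
move=> /andP[j0 jn].
(* The default value of [inord] is never reached, since the order is at most [j <= n]. *)
rewrite (partition_big (fun t => inord (order rot1t t) : 'I_n.+1) xpredT)//=.
apply: eq_bigr => m _.
have ordn (t : j.-tuple 'I_N) : (order rot1t t < n.+1)%N.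
  by rewrite ltnS (leq_trans _ jn)// dvdn_leq// order_rot1t_dvd.
transitivity (\sum_(t : j.-tuple 'I_N | order rot1t t == m) walk_weight A (val t)).
  by apply: eq_bigl => t; rewrite -val_eqE /= inordK.
have [mj|mj] := boolP (m %| j)%N; last first.
  rewrite [RHS]big1// big1// => t /eqP tm.
  by have := order_rot1t_dvd _ t; rewrite tm (negbTE mj).
have m0 := dvdn_gt0 j0 mj.
rewrite sum_period// (sum_orbits A m (fun x => x ^+ (j %/ m)))//.
(* The exponent [j %/ m] is positive, so the power of 0 is 0, as [sum_orbits] requires. *)
by rewrite expr0n eqn0Ngt divn_gt0// dvdn_leq.
Qed.

Lemma big_tupleS (V : nmodType) (T : finType) n (F : n.+1.-tuple T -> V) :
  \sum_(t : n.+1.-tuple T) F t =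
  \sum_(x : T) \sum_(t : n.-tuple T) F [tuple of x :: t].
Proof.
rewrite pair_big /=.
rewrite (reindex (fun p : T * n.-tuple T => [tuple of p.1 :: p.2])) //=.
exists (fun t => (thead t, [tuple of behead t])) => [[x t] _|t _].
  by rewrite theadE; congr (_, _); apply: val_inj.
by rewrite /= -tuple_eta.
Qed.

(** The tuple lists the [n] interior vertices of a path of [n.+1] steps. *)
Lemma exp_mx_sum_paths A n i j :
  (A ^+ n.+1) i j = \sum_(t : n.-tuple 'I_N)
    \prod_(p <- zip (i :: val t) (rcons (val t) j)) A p.1 p.2.
Proof.
elim: n i => [|n IH] i.
  rewrite expr1 (big_pred1 [tuple]) => [|t]; first by rewrite big_seq1.
  by rewrite [t]tuple0; apply/esym/eqP.
rewrite exprS -mulmxE mxE big_tupleS; apply: eq_bigr => k _.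
by rewrite IH mulr_sumr; apply: eq_bigr => t _; rewrite /= big_cons.
Qed.

Lemma mxtrace_exp A n : (0 < n)%N ->
  \tr (A ^+ n) = \sum_(t : n.-tuple 'I_N) walk_weight A (val t).
Proof.
case: n => // n _; rewrite big_tupleS; apply: eq_bigr => i _.
rewrite exp_mx_sum_paths; apply: eq_bigr => t _.
by rewrite /walk_weight rot1_cons.
Qed.

(** The formal product over orbits, truncated to those of length at most [n]. *)
Definition orbit_poly A n : {poly R} :=
  \prod_(m < n.+1) \prod_(O in orbits A m) (1 - orbit_weight A O *: 'X^m).

End Counting.

(** * The determinant as a sum of coefficients of the orbit product *)

Section DetFormula.
Variables (R : realType) (N : nat).
Implicit Types (A : 'M[R]_N).
Local Notation toC := (real_complex R).

Lemma logderiv_orbit_poly A n : has_logderiv _ n (map_poly toC (orbit_poly A n))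
  (fun j => \sum_(m < n.+1) \sum_(O in orbits A m)
     if (m %| j)%N then (toC (orbit_weight A O)) ^+ (j %/ m) *+ m else 0).
Proof.
rewrite rmorph_prod /=; apply: has_logderiv_prod => m _.
rewrite rmorph_prod /=; apply: has_logderiv_prod => O Om.
rewrite rmorphB /= rmorph1 map_polyZ /= map_polyXn.
apply: has_logderiv_factor.
exact: orbits_gt0 Om.
Qed.

Lemma size_poly_prod_1sub (F : idomainType) (s : seq F) :
  (size (\prod_(x <- s) (1 - x *: 'X^1) : {poly F})%R <= (size s).+1)%N.
Proof.
elim: s => [|x s IH]; first by rewrite big_nil size_poly1.
rewrite big_cons (leq_trans (size_polyMleq _ _))//.
have s2 : (size (1 - x *: 'X^1 : {poly F})%R <= 2)%N.
  rewrite (leq_trans (size_polyD _ _))// size_polyN geq_max size_poly1 /=.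
  by rewrite (leq_trans (size_scale_leq _ _))// size_polyXn.
by rewrite -subn1 leq_subLR (leq_trans (leq_add s2 IH)).
Qed.

(** The reversed characteristic polynomial and [orbit_poly] have the same logarithmic derivative up
    to order [n], hence the same coefficients there. The former has degree at most [N <= n], so
    these coefficients sum to its value at 1. *)
Lemma det_eq_coef_orbit_poly A n : (N <= n)%N ->
  \det (1%:M - A) = \sum_(k < n.+1) (orbit_poly A n)`_k.
Proof.
move=> Nn.
have [s [chi trs]] := char_poly_roots _ _ (map_mx toC A).
have sN : size s = N.
  have := size_char_poly (map_mx toC A); rewrite chi size_prod_XsubC => -[].
  by [].
(* This is [det (1 - X A)], factored over the complex eigenvalues. *)
pose D : {poly R[i]} := \prod_(x <- s) (1 - x *: 'X^1).
have D1 : D.[1] = toC (\det (1%:M - A)).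
  have -> : toC (\det (1%:M - A)) = (char_poly (map_mx toC A)).[1].
    rewrite -det_map_mx rmorphB /= map_mx1 /char_poly -horner_evalE -det_map_mx.
    congr (\det _); apply/matrixP => i j; rewrite !mxE.
    by rewrite /= horner_evalE hornerD hornerN hornerMn hornerX hornerC.
  rewrite chi !horner_prod; apply: eq_bigr => x _.
  by rewrite !hornerE.
have Dld : has_logderiv _ n D (fun j => \sum_(x <- s) x ^+ j).
  have -> : (fun j => \sum_(x <- s) x ^+ j) = fun j =>
      \sum_(x <- s) if (1 %| j)%N then x ^+ (j %/ 1) *+ 1 else 0.
    by apply: funext => j; apply: eq_bigr => x _; rewrite dvd1n divn1.
  by apply: has_logderiv_prod => x _; apply: has_logderiv_factor.
have ED : eqmodX _ n (map_poly toC (orbit_poly A n)) D.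
  apply: has_logderiv_inj (logderiv_orbit_poly A n) Dld _ => j jn.
  rewrite -trs -rmorphXn [RHS]trace_map_mx mxtrace_exp; last by case/andP: jn.
  rewrite (sum_walk_weight _ _ _ jn) rmorph_sum; apply: eq_bigr => m _.
  rewrite rmorph_sum; apply: eq_bigr => O _; case: ifP => _; last by rewrite rmorph0.
  by rewrite rmorphMn rmorphXn.
apply: (fmorph_inj toC); transitivity D.[1]; first by rewrite D1.
rewrite rmorph_sum.
have sD : (size D <= n.+1)%N.
  apply: (leq_trans (size_poly_prod_1sub _ s)); by rewrite ltnS sN.
rewrite (horner_coef_wide _ sD); apply: eq_bigr => k _.
by rewrite expr1n mulr1 -ED ?coef_map// -ltnS ltn_ord.
Qed.
End DetFormula.

(** * Convergence of the Euler product *)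

Section Estimates.
Context {R : realType}.
Implicit Types (p q : {poly R}).

Definition coef_dominated p q := forall k, `|p`_k| <= q`_k.

Lemma coef_dominatedM p p' q q' : coef_dominated p q -> coef_dominated p' q' ->
  coef_dominated (p * p') (q * q').
Proof.
move=> pq pq' k; rewrite !coefM (le_trans (ler_norm_sum _ _ _))//.
by apply: ler_sum => i _; rewrite normrM ler_pM.
Qed.

Lemma coef_dominated1 : coef_dominated 1 1.
Proof. by move=> k; rewrite coef1; case: eqP => _; rewrite ?normr1 ?normr0. Qed.

Lemma coef_dominated_prod (I : Type) (r : seq I) (P : pred I) (p q : I -> {poly R}) :
  (forall i, P i -> coef_dominated (p i) (q i)) ->
  coef_dominated (\prod_(i <- r | P i) p i) (\prod_(i <- r | P i) q i).
Proof.
by move=> h; apply: big_ind2 => //; [exact: coef_dominated1|move=> ? ? ? ?; exact: coef_dominatedM].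
Qed.

Lemma coef_dominated_factor (a : R) m :
  coef_dominated (1 - a *: 'X^m) (1 + `|a| *: 'X^m).
Proof.
move=> k; rewrite coefB coefD !coefZ coef1 coefXn (le_trans (ler_normB _ _))//.
by rewrite normrM lerD//; case: eqP => _; rewrite ?normr1 ?normr0.
Qed.

(* [p.[1]] minus its truncation at order [n] is at most [\sum_(k > n) q`_k],
   and [q`_k <= s^-n * q`_k * s^k] for [k >= n]. *)
Lemma coef_dominated_tail p q n (s : R) : 1 <= s -> coef_dominated p q ->
  s ^+ n * `|p.[1] - \sum_(k < n.+1) p`_k| <= q.[s].
Proof.
move=> s1 pq; have s0 : 0 <= s by apply: le_trans s1.
pose M := (n.+1 + (size p + size q))%N.
have pM : (size p <= M)%N by rewrite /M addnCA leq_addr.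
have qM : (size q <= M)%N by rewrite /M !addnA leq_addl.
have nM : (n.+1 <= M)%N by rewrite leq_addr.
rewrite (horner_coef_wide _ pM) (horner_coef_wide _ qM).
under eq_bigr do rewrite expr1n mulr1.
rewrite -!(big_mkord xpredT (fun k => p`_k)) (big_cat_nat (leq0n _) nM) /=.
rewrite addrAC subrr add0r.
rewrite -(big_mkord xpredT (fun k => q`_k * s ^+ k)) (big_cat_nat (leq0n _) nM) /=.
rewrite -[leLHS]add0r lerD//.
  by rewrite sumr_ge0// => k _; rewrite mulr_ge0 ?exprn_ge0// (le_trans _ (pq k)).
rewrite (le_trans (ler_wpM2l (exprn_ge0 _ s0) (ler_norm_sum _ _ _)))//.
rewrite mulr_sumr; apply: ler_sum_nat => k /andP[nk _].
by rewrite mulrC ler_pM ?exprn_ge0// ler_weXn2l// ltnW.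
Qed.

Lemma sum_geometric_le n (t : R) : 0 <= t -> t < 1 ->
  \sum_(i < n) t ^+ i <= (1 - t)^-1.
Proof.
move=> t0 t1; have t1' : 0 < 1 - t by rewrite subr_gt0.
rewrite -[leRHS]mul1r ler_pdivlMr// mulrC.
by rewrite -[leLHS]opprK -mulNr opprB -subrX1 opprB gerBl exprn_ge0.
Qed.

Lemma geometric_small (c t e : R) : 0 <= t -> t < 1 -> 0 < e ->
  exists n, (0 < n)%N /\ `|c| * t ^+ n < e.
Proof.
move=> t0 t1 e0.
have /cvgr0Pnorm_lt /(_ _ e0) : (geometric `|c| t x @[x --> \oo] --> 0)%classic.
  by apply: cvg_geometric; rewrite ger0_norm.
case=> n _ h; exists n.+1; split=> //.
have /= := h n.+1 (leqnSn n); apply: le_lt_trans.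
by rewrite ler_norm.
Qed.

(** Weierstrass's product inequality. *)
Lemma prod_1sub_ge (I : Type) (r : seq I) (P : pred I) (y : I -> R) :
  (forall i, P i -> 0 <= y i <= 1) ->
  1 - \sum_(i <- r | P i) y i <= \prod_(i <- r | P i) (1 - y i).
Proof.
move=> h.
(* The upper bound 1 on the product is carried along to make the induction work. *)
suff : 1 - \sum_(i <- r | P i) y i <= \prod_(i <- r | P i) (1 - y i) <= 1 by case/andP.
elim: r => [|i r /andP[IH1 IH2]]; first by rewrite !big_nil subr0 lexx.
rewrite !big_cons; case: ifP => Pi; last by rewrite IH1 IH2.
have /andP[y0 y1] := h _ Pi.
have p0 : 0 <= \prod_(i <- r | P i) (1 - y i).
  by apply: prodr_ge0 => j /h /andP[_ ?]; rewrite subr_ge0.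
apply/andP; split; last by rewrite mulr_ile1 ?subr_ge0// gerBl.
rewrite mulrBl mul1r opprD addrCA addrC lerB//.
by rewrite -[leRHS]mulr1 ler_wpM2l.
Qed.

End Estimates.

(** * Limit of the orbit products and nonvanishing of the determinant *)

Section EulerProduct.
Context {R : realType} {N : nat}.
Variables (A : 'M[R]_N) (C r : R).
Hypotheses (r0 : 0 <= r) (r1 : r < 1).
Hypothesis AC : forall m, (0 < m)%N ->
  \sum_(t : m.-tuple 'I_N) `|walk_weight A (val t)| <= C * r ^+ m.

(** Each orbit accounts for [m >= 1] walks. The norm of [C] keeps the bound nonnegative at [m = 0]
    too, where there are no orbits. *)
Lemma sum_orbit_weight_le m :
  \sum_(O in orbits A m) `|orbit_weight A O| <= `|C| * r ^+ m.
Proof.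
have [->|m0] := posnP m.
  rewrite big_pred0 ?mulr_ge0 ?exprn_ge0// => O.
  by apply/negP => /orbits_gt0.
rewrite (@le_trans _ _ (C * r ^+ m))//; last by rewrite ler_wpM2r ?exprn_ge0 ?ler_norm.
apply: le_trans (AC _ m0).
apply: le_trans (_ : \sum_(O in orbits A m) `|orbit_weight A O| *+ m <= _).
  by apply: ler_sum => O _; rewrite -mulr_natr ler_peMr// ler1n.
rewrite -(sum_orbits A m Num.norm m0 (normr0 _)) [leLHS]big_mkcond.
by apply: ler_sum => t _; case: ifP.
Qed.

(** If the weight had norm at least 1, so would all powers of the walk, whereas the bound on walks
    of length [k * m] tends to 0. *)
Lemma orbit_weight_lt1 m (O : {set m.-tuple 'I_N}) : O \in orbits A m ->
  `|orbit_weight A O| < 1.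
Proof.
move=> Om; have m0 := orbits_gt0 _ _ _ Om; case/imsetP: Om => t _ ->.
rewrite orbit_weight_orbit_of ltNge; apply/negP => w1.
have [k [k0 kC]] := geometric_small C r 1 r0 r1 ltr01.
have : 1 <= `|C| * r ^+ k; last by rewrite leNgt kC.
have km0 : (0 < k * m)%N by rewrite muln_gt0 k0.
apply: (@le_trans _ _ (`|walk_weight A (val (powt k t))|)).
  by rewrite /= walk_weight_power normrX exprn_ege1.
apply: (@le_trans _ _ (C * r ^+ (k * m))).
  apply: le_trans (AC _ km0).
  by rewrite (bigD1 (powt k t))//= lerDl sumr_ge0.
apply: (@le_trans _ _ (`|C| * r ^+ (k * m))).
  by rewrite ler_wpM2r ?exprn_ge0 ?ler_norm.
rewrite ler_wpM2l// ler_wiXn2l ?(ltW r1)//.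
by rewrite leq_pmulr.
Qed.

Definition orbit_prod n : R := \prod_(m < n.+1) \prod_(O in orbits A m) (1 - orbit_weight A O).

Lemma orbit_prodE n : orbit_prod n = (orbit_poly A n).[1].
Proof.
rewrite /orbit_poly horner_prod; apply: eq_bigr => m _.
rewrite horner_prod; apply: eq_bigr => O _.
by rewrite !hornerE expr1n mulr1.
Qed.

(** The difference is the tail of [orbit_poly] beyond order [n]. Its majorant, evaluated at
    [q^-1 > 1], is bounded independently of [n], which makes the tail [O(q^n)]. *)
Lemma orbit_prod_cvg : (orbit_prod n @[n --> \oo] --> \det (1%:M - A))%classic.
Proof.
(* The midpoint of [r] and 1: then [q < 1], and [r / q < 1] still gives a convergent geometric
   series. *)
pose q := (1 + r) / 2; have q0 : 0 < q by rewrite divr_gt0// ltr_wpDr.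
have q1 : q < 1 by rewrite ltr_pdivrMr// mul1r ltrD2l.
have rq : r / q < 1.
  by rewrite ltr_pdivrMr// mul1r ltr_pdivlMr// mulr_natr mulr2n ltrD2r.
have rq0 : 0 <= r / q by rewrite divr_ge0// ltW.
(* Obtained from [1 + x <= expR x] on each factor and from the geometric series of ratio [r / q]. *)
pose K := expR (`|C| * (1 - r / q)^-1).
have bnd n : (N <= n)%N -> `|orbit_prod n - \det (1%:M - A)| <= K * q ^+ n.
  move=> Nn; rewrite (det_eq_coef_orbit_poly _ _ _ _ Nn) orbit_prodE.
  pose G := \prod_(m < n.+1) \prod_(O in orbits A m) (1 + `|orbit_weight A O| *: 'X^m) : {poly R}.
  have dG : coef_dominated (orbit_poly A n) G.
    apply: coef_dominated_prod => m _; apply: coef_dominated_prod => O _.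
    exact: coef_dominated_factor.
  have q1V : 1 <= q^-1 by rewrite invf_ge1// ltW.
  have := coef_dominated_tail _ _ n _ q1V dG.
  rewrite exprVn mulrC ler_pdivrMr ?exprn_gt0// => /le_trans -> //.
  rewrite ler_pM2r ?exprn_gt0//.
  rewrite /G horner_prod.
  apply: (@le_trans _ _ (\prod_(m < n.+1) expR (`|C| * (r / q) ^+ m))).
    apply: ler_prod => m _; rewrite horner_prod; apply/andP; split.
      apply: prodr_ge0 => O _; rewrite !hornerE addr_ge0// mulr_ge0// exprn_ge0//.
      by rewrite invr_ge0 ltW.
    apply: (@le_trans _ _ (\prod_(O in orbits A m) expR (`|orbit_weight A O| * q^-1 ^+ m))).
      apply: ler_prod => O _; rewrite !hornerE expR_ge1Dx andbT addr_ge0// mulr_ge0//.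
      by rewrite exprn_ge0// invr_ge0 ltW.
    rewrite -expR_sum ler_expR -mulr_suml expr_div_n -exprVn mulrA.
    by rewrite ler_wpM2r ?sum_orbit_weight_le// exprn_ge0// invr_ge0 ltW.
  rewrite -expR_sum ler_expR -mulr_sumr ler_wpM2l//.
  exact: sum_geometric_le.
apply/cvgrPdistC_lt => e e0.
have [n0 [_ hn0]] := geometric_small K q e (ltW q0) q1 e0.
near=> n.
have nN : (N <= n)%N by near: n; exact: nbhs_infty_ge.
have nn0 : (n0 <= n)%N by near: n; exact: nbhs_infty_ge.
apply: le_lt_trans (bnd _ nN) _; apply: le_lt_trans hn0.
rewrite ger0_norm ?expR_ge0// ler_wpM2l ?expR_ge0//.
by rewrite ler_wiXn2l// ltW.
Unshelve. all: by end_near.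
Qed.

Lemma orbit_prod_neq0 n : orbit_prod n != 0.
Proof.
apply/prodf_neq0 => m _; apply/prodf_neq0 => O Om.
rewrite subr_eq0; apply/negP => /eqP E.
by have := orbit_weight_lt1 _ _ Om; rewrite -E normr1 ltxx.
Qed.

(** The partial products are nonzero but could tend to 0. Beyond a suitable [M], however, the
    remaining factors multiply to at least one half in norm. *)
Lemma det_1sub_neq0 : \det (1%:M - A) != 0.
Proof.
(* With this [M], the sum of [|C| * r ^+ m] over [m >= M] is below one half. *)
have [M [_ hM]] : exists n, (0 < n)%N /\ `| `|C| / (1 - r)| * r ^+ n < 2^-1.
  by apply: geometric_small; rewrite // invr_gt0 ltr0n.
rewrite ger0_norm in hM; last by rewrite divr_ge0// subr_ge0 ltW.
have bnd n : (M <= n)%N -> `|orbit_prod M| / 2 <= `|orbit_prod n|.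
  move=> Mn; rewrite /orbit_prod.
  rewrite -!(big_mkord xpredT (fun m => \prod_(O in orbits A m) (1 - orbit_weight A O))).
  rewrite [in leRHS](big_cat_nat (leq0n _) (_ : M.+1 <= n.+1)%N)//= normrM.
  rewrite ler_wpM2l// normr_prod.
  (* A bound for the loss caused by the orbits of length [m]. Weierstrass's inequality is used
     twice: across the lengths, and inside each length to get [y m <= |C| * r ^+ m]. *)
  pose y m := 1 - \prod_(O in orbits A m) (1 - `|orbit_weight A O|).
  have P01 m : 0 <= \prod_(O in orbits A m) (1 - `|orbit_weight A O|) <= 1.
    apply/andP; split; first by apply: prodr_ge0 => O Om; rewrite subr_ge0 ltW// orbit_weight_lt1.
    apply: prodr_ile1 => O Om; rewrite subr_ge0 ltW ?orbit_weight_lt1//=.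
    by rewrite gerBl.
  apply: (@le_trans _ _ (\prod_(M.+1 <= m < n.+1) (1 - y m))); last first.
    apply: ler_prod => m _; rewrite /y subKr; have /andP[-> _] /= := P01 m.
    rewrite normr_prod; apply: ler_prod => O Om.
    rewrite subr_ge0 ltW ?orbit_weight_lt1//=.
    by rewrite -[X in X - _]normr1 lerB_dist.
  apply: (@le_trans _ _ (1 - \sum_(M.+1 <= m < n.+1) y m)); last first.
    apply: prod_1sub_ge => m _; have /andP[P0 P1] := P01 m.
    by rewrite /y subr_ge0 P1 gerBl.
  rewrite lerBrDr -lerBrDl [X in _ <= X](_ : _ = 2^-1); last by rewrite {1}(splitr 1) mul1r addrK.
  apply: le_trans (ltW hM).
  apply: (@le_trans _ _ (\sum_(M.+1 <= m < n.+1) `|C| * r ^+ m)).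
    apply: ler_sum => m _; apply: le_trans (sum_orbit_weight_le m).
    rewrite /y lerBlDr -lerBlDl; apply: prod_1sub_ge => O Om.
    by rewrite normr_ge0 ltW// orbit_weight_lt1.
  rewrite -mulr_sumr -mulrA ler_wpM2l//.
  apply: (@le_trans _ _ (\sum_(M <= m < n.+1) r ^+ m)).
    by rewrite [leRHS]big_ltn ?ltnS// lerDr exprn_ge0.
  rewrite -{1}(add0n M) big_addn big_mkord.
  under eq_bigr do rewrite exprD.
  by rewrite -mulr_suml ler_wpM2r ?exprn_ge0// sum_geometric_le.
have c0 : 0 < `|orbit_prod M| / 2 by rewrite divr_gt0// normr_gt0 orbit_prod_neq0.
apply/negP => /eqP d0; have := orbit_prod_cvg; rewrite d0 => /cvgr0Pnorm_lt/(_ _ c0)[n _ h].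
have /= := h (maxn n M) (leq_maxl _ _); rewrite ltNge bnd//.
exact: leq_maxr.
Qed.

Lemma orbit_prod_inv_cvg :
  ((orbit_prod n)^-1 @[n --> \oo] --> (\det (1%:M - A))^-1)%classic.
Proof. by apply: cvgV; [exact: det_1sub_neq0|exact: orbit_prod_cvg]. Qed.

End EulerProduct.

(** * Restriction to a block *)

Section Restriction.
Context {R : realType} {N : nat}.
Implicit Types (A : 'M[R]_N) (B : {set 'I_N}).

(** The block padded with zeros: keeping size [N], its orbits are sets of the same tuples as those
    of [A]. *)
Definition restrict_mx A B : 'M[R]_N :=
  \matrix_(i, j) if (i \in B) && (j \in B) then A i j else 0.

(** With [J] the coordinate inclusion of the block, the two matrices are [J^T *m Y] and [Y *m J^T]
    for [Y = principal_submx A B *m J]; Sylvester's identity applies. *)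
Lemma det_restrict_mx A B :
  \det (1%:M - restrict_mx A B) = \det (1%:M - principal_submx A B).
Proof.
pose J : 'M[R]_(#|B|, N) := \matrix_(i, j) (enum_val i == j)%:R.
have JA : principal_submx A B *m J = \matrix_(i, j) if j \in B then A (enum_val i) j else 0.
  apply/matrixP => i j; rewrite !mxE; case: ifP => jB; last first.
    rewrite big1// => k _; rewrite !mxE; case: eqP => [kj|]; last by rewrite mulr0.
    by move: jB; rewrite -kj enum_valP.
  rewrite (bigD1 (enum_rank_in jB j))//= !mxE enum_rankK_in// eqxx mulr1.
  rewrite big1 ?addr0// => k kj; rewrite !mxE; case: eqP => [E|]; last by rewrite mulr0.
  by case/eqP: kj; apply: enum_val_inj; rewrite enum_rankK_in.
have E1 : restrict_mx A B = J^T *m (principal_submx A B *m J).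
  rewrite JA; apply/matrixP => i j; rewrite !mxE; case: (boolP (i \in B)) => iB /=; last first.
    rewrite big1// => k _; rewrite !mxE; case: eqP => [ki|]; last by rewrite mul0r.
    by move: iB; rewrite -ki enum_valP.
  rewrite (bigD1 (enum_rank_in iB i))//= !mxE enum_rankK_in// eqxx mul1r.
  rewrite big1 ?addr0// => k kj; rewrite !mxE; case: eqP => [E|]; last by rewrite mul0r.
  by case/eqP: kj; apply: enum_val_inj; rewrite enum_rankK_in.
have E2 : principal_submx A B = (principal_submx A B *m J) *m J^T.
  rewrite JA; apply/matrixP => i j; rewrite !mxE.
  rewrite (bigD1 (enum_val j))//= !mxE enum_valP eqxx mulr1.
  by rewrite big1 ?addr0// => k kj; rewrite !mxE eq_sym (negbTE kj) mulr0.
by rewrite E1 [in RHS]E2 det_sub1_mulmx.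
Qed.

Lemma prod_restrict_mx A B (s t : seq 'I_N) : size s = size t ->
  \prod_(p <- zip s t) restrict_mx A B p.1 p.2 =
  if all [in B] s && all [in B] t then \prod_(p <- zip s t) A p.1 p.2 else 0.
Proof.
elim: s t => [|x s IH] [|y t]//=; first by rewrite !big_nil.
move=> [st]; rewrite !big_cons IH// mxE /=.
case: (x \in B) (y \in B) => -[] /=; rewrite ?mul0r ?andbF//.
by case: ifP => _; rewrite ?mulr0.
Qed.

Lemma walk_weight_restrict_mx A B (s : seq 'I_N) :
  walk_weight (restrict_mx A B) s =
  if all [in B] s then walk_weight A s else 0.
Proof.
rewrite /walk_weight prod_restrict_mx ?size_rot//.
by rewrite (eq_all_r (mem_rot 1 s)) andbb.
Qed.

Lemma covered_orbit_of m (t : m.-tuple 'I_N) B :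
  covered (orbit_of t) B = all [in B] (val t).
Proof.
apply/forall_inP/idP => [h|tB t'].
  by apply: h; rewrite inE; apply/existsP; exists ord0; rewrite rot0.
by rewrite inE => /existsP[k /eqP ->]; rewrite (eq_all_r (mem_rot k _)).
Qed.

(** A closed walk leaving [B] has weight 0 after restriction, and weights inside [B] are
    unchanged. *)
Lemma orbits_restrict_mx A B m :
  orbits (restrict_mx A B) m = [set O in orbits A m | covered O B].
Proof.
have tP (t : m.-tuple 'I_N) : (0 < m)%N -> primitive_walk (restrict_mx A B) (val t) <->
    primitive_walk A (val t) /\ all [in B] (val t).
  move=> m0; rewrite !primitive_walkP// walk_weight_restrict_mx.
  by case: ifP => _; rewrite ?eqxx; split=> [[]|[]].
apply/setP => O; rewrite inE; apply/idP/andP.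
  move=> OA; have m0 := orbits_gt0 _ _ _ OA; case/imsetP: OA => t.
  rewrite inE => /asboolP /(tP t m0)[pt tB] ->; rewrite covered_orbit_of; split=> //.
  by apply/imsetP; exists t => //; rewrite inE; apply/asboolP.
move=> [OA]; have m0 := orbits_gt0 _ _ _ OA; case/imsetP: OA => t.
rewrite inE => /asboolP pt ->; rewrite covered_orbit_of => tB.
by apply/imsetP; exists t => //; rewrite inE; apply/asboolP/tP.
Qed.

Lemma orbit_weight_restrict_mx A B m (O : {set m.-tuple 'I_N}) :
  O \in orbits (restrict_mx A B) m ->
  orbit_weight (restrict_mx A B) O = orbit_weight A O.
Proof.
rewrite orbits_restrict_mx inE => /andP[/imsetP[t _ ->]].
by rewrite covered_orbit_of !orbit_weight_orbit_of walk_weight_restrict_mx => ->.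
Qed.

Lemma orbit_prod_restrict_mx A B n :
  orbit_prod (restrict_mx A B) n =
  \prod_(m < n.+1) \prod_(O in orbits A m | covered O B) (1 - orbit_weight A O).
Proof.
apply: eq_bigr => m _; apply: eq_big => [O|O /orbit_weight_restrict_mx->//].
by rewrite orbits_restrict_mx inE.
Qed.

(** * From the spectral radius to a geometric bound on closed walks *)

Lemma walk_weight_mx_abs A (s : seq 'I_N) :
  walk_weight (mx_abs A) s = `|walk_weight A s|.
Proof. by rewrite /walk_weight normr_prod; apply: eq_bigr => p _; rewrite mxE. Qed.

(** The sum is the trace of the [m]-th power of [mx_abs A], hence a sum of [N] eigenvalue powers;
    [r] bounds the moduli of the eigenvalues. *)
Lemma spectral_radius_bound A : spectral_radius_lt1 (mx_abs A) ->
  exists r : R, [/\ 0 <= r, r < 1 & forall m, (0 < m)%N ->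
    \sum_(t : m.-tuple 'I_N) `|walk_weight A (val t)| <= N%:R * r ^+ m].
Proof.
move=> rho; set M := map_mx (real_complex R) (mx_abs A).
have [s [chi trs]] := char_poly_roots _ _ M.
have sN : size s = N.
  by have := size_char_poly M; rewrite chi size_prod_XsubC => -[].
(* The eigenvalues are finitely many, so their moduli have a common real bound below 1. *)
have [r [r0 r1 sr]] : exists r : R, [/\ 0 <= r, r < 1 & forall x, x \in s -> `|x| <= r%:C%C].
  have : forall x, x \in s -> `|x| < 1.
    by move=> x xs; apply: rho; rewrite -/M chi root_prod_XsubC.
  elim: s {chi trs sN} => [|x s IH] h; first by exists 0; split=> //; exact: ltr01.
  have [y ys|r [r0 r1 hr]] := IH; first by apply: h; rewrite inE ys orbT.
  have /RRe_real xE : `|x| \is Num.real by exact: normr_real.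
  have x1 : complex.Re `|x| < 1.
    by rewrite -ltcR xE; apply: h; rewrite mem_head.
  exists (Num.max r (complex.Re `|x|)); split.
  - by rewrite le_max r0.
  - by rewrite gt_max r1.
  - move=> y; rewrite inE => /orP[/eqP ->|/hr/le_trans->//].
      by rewrite -{1}xE lecR le_max lexx orbT.
    by rewrite lecR le_max lexx.
exists r; split=> // m m0.
(* A nonnegative trace equals its own norm, so the triangle inequality over the eigenvalues
   applies. *)
have tr0 : 0 <= (\tr (mx_abs A ^+ m))%:C%C.
  rewrite lecR mxtrace_exp// sumr_ge0// => t _.
  by rewrite walk_weight_mx_abs.
under eq_bigr do rewrite -walk_weight_mx_abs.
rewrite -mxtrace_exp// -lecR -(ger0_norm tr0).
have -> : (\tr (mx_abs A ^+ m))%:C%C = \tr (M ^+ m).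
  by rewrite -rmorphXn [RHS]trace_map_mx.
rewrite trs; apply: le_trans (ler_norm_sum _ _ _) _.
apply: (@le_trans _ _ (\sum_(x <- s) (r%:C%C) ^+ m)).
  rewrite big_seq [leRHS]big_seq; apply: ler_sum => x xs.
  by rewrite normrX lerXn2r ?nnegrE ?(le_trans _ (sr _ xs))// sr.
rewrite big_const_seq count_predT sN iter_addr_0 rmorphM /= rmorphXn /= rmorph_nat.
by rewrite mulr_natl.
Qed.

End Restriction.

(** * Block weights *)

Section BlockWeights.
Context {N : nat}.
Implicit Types (fam : {set {set 'I_N}}) (B : {set 'I_N}).

(** The complement shrinks strictly at each proper inclusion, so the fuel cannot run out before the
    supersets do. *)
Lemma wB_rec_fuel fam n n' B : (#|~: B| <= n)%N -> (#|~: B| <= n')%N ->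
  wB_rec fam n B = wB_rec fam n' B.
Proof.
have card_lt (X Y : {set 'I_N}) : X \proper Y -> (#|~: Y| < #|~: X|)%N.
  by move=> XY; apply: proper_card; rewrite properC.
have top (X Y : {set 'I_N}) : #|~: X| = 0%N -> ~~ (X \proper Y).
  by move=> X0; apply/negP => /card_lt; rewrite X0.
elim: n n' B => [|n IH] [|n'] B //=.
- rewrite leqn0 => /eqP B0 _; rewrite big_pred0 ?subr0// => B'.
  by rewrite (negbTE (top _ B' B0)) andbF.
- move=> _; rewrite leqn0 => /eqP B0; rewrite big_pred0 ?subr0// => B'.
  by rewrite (negbTE (top _ B' B0)) andbF.
- move=> Bn Bn'; congr (1 - _); apply: eq_bigr => B' /andP[_ /card_lt lt].
  by apply: IH; rewrite -ltnS; apply: leq_trans lt _.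
Qed.

Lemma block_weightE fam B :
  block_weight fam B = 1 - \sum_(B' in fam | B \proper B') block_weight fam B'.
Proof.
rewrite /block_weight (wB_rec_fuel _ _ #|~: B|.+1)//=; congr (1 - _).
apply: eq_bigr => B' /andP[_ BB']; apply: wB_rec_fuel => //.
by apply: ltnW; apply: proper_card; rewrite properC.
Qed.

(* The members of [fam] containing [V] are those containing their intersection [B0],
   which is itself a member. *)
Lemma sum_block_weight fam (V : {set 'I_N}) :
  (forall B B', B \in fam -> B' \in fam -> B :&: B' \in fam) ->
  (exists2 B, B \in fam & V \subset B) ->
  \sum_(B in fam | V \subset B) block_weight fam B = 1.
Proof.
move=> famI [B1 B1f VB1].
(* Taken of least cardinality: intersecting [B0] with another member containing [V] cannot shrink
   it. *)
have [B0 /andP[B0f VB0] B0min] :=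
  @arg_minnP _ B1 [pred B | (B \in fam) && (V \subset B)] (fun B => #|B|)
    (introT andP (conj B1f VB1)).
have sub B : B \in fam -> (V \subset B) = (B0 \subset B).
  move=> Bf; apply/idP/idP => [VB|]; last exact: fintype.subset_trans.
  have : B0 :&: B == B0.
    rewrite eqEcard subsetIl /=; apply: B0min; rewrite /= famI//=.
    by rewrite finset.subsetI VB0.
  by move/eqP/finset.setIidPl.
rewrite (bigD1 B0) ?B0f//= [X in X + _]block_weightE.
rewrite [X in _ + X](eq_bigl (fun B => (B \in fam) && (B0 \proper B))) ?subrK// => B.
by case: (boolP (B \in fam)) => //= Bf; rewrite sub// finset.properEneq andbC eq_sym.
Qed.

End BlockWeights.

(** * Integer powers and the product over the blocks *)

Lemma prod_exprz (F : fieldType) (I : Type) (r : seq I) (P : pred I) (x : I -> F) (w : int) :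
  (\prod_(i <- r | P i) x i) ^ w = \prod_(i <- r | P i) x i ^ w.
Proof.
by apply: (big_morph (fun y => y ^ w)) => [a b|]; [exact: expfzMl|exact: exp1rz].
Qed.

Lemma expfz_sum (F : fieldType) (I : Type) (r : seq I) (P : pred I) (x : F) (w : I -> int) :
  x != 0 -> x ^ (\sum_(i <- r | P i) w i) = \prod_(i <- r | P i) x ^ w i.
Proof. by move=> x0; apply: (big_morph (fun k => x ^ k)) => [a b|]; rewrite ?expr0z ?expfzDr. Qed.

Lemma cvg_exprz (R : realType) (u : nat -> R) (l : R) (w : int) : l != 0 ->
  (u n @[n --> \oo] --> l -> u n ^ w @[n --> \oo] --> l ^ w)%classic.
Proof.
move=> l0 ul.
have uX k : (u n ^+ k @[n --> \oo] --> l ^+ k)%classic.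
  elim: k => [|k IH].
    by under eq_fun do rewrite expr0; rewrite expr0; apply: cvg_cst.
  by under eq_fun do rewrite exprS; rewrite exprS; apply: cvgM.
case: w => k; first exact: uX.
by apply: cvgV; [rewrite expf_neq0|exact: uX].
Qed.

Local Open Scope classical_set_scope.
Local Open Scope ring_scope.

Theorem theorem6 (R : realType) (N : nat) (A : 'M[R]_N) (L : nat)
  (fam : {set {set 'I_N}}) :
  spectral_radius_lt1 (mx_abs A) ->
  (1 <= L)%N ->
  (forall (m : nat) (O : {set m.-tuple 'I_N}),
      O \in orbits A m -> (m < L)%N -> exists2 B, B \in fam & covered O B) ->
  (forall B B', B \in fam -> B' \in fam -> B :&: B' \in fam) ->
  (fun n : nat => orbit_partial_prod A fam n) @ \oo --> Z_fam A fam.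
Proof.
move=> /spectral_radius_bound[r [r0 r1 AC]] _ _ famI.
(* Restriction only kills weights, so the same constants serve every block. *)
have BC B m : (0 < m)%N ->
    \sum_(t : m.-tuple 'I_N) `|walk_weight (restrict_mx A B) (val t)| <= N%:R * r ^+ m.
  move=> m0; apply: le_trans (AC _ m0); apply: ler_sum => t _.
  by rewrite walk_weight_restrict_mx; case: ifP => // _; rewrite normr0.
(* An exact identity at each finite [n]: after the products are exchanged, the factor of an orbit
   carries the sum of the weights of the blocks covering it. *)
have partialE n : orbit_partial_prod A fam n =
    \prod_(B in fam) (orbit_prod (restrict_mx A B) n)^-1 ^ block_weight fam B.
  rewrite /orbit_partial_prod.
  have orbit_prod_exprz B (w : int) : (orbit_prod (restrict_mx A B) n)^-1 ^ w =
      \prod_(m < n.+1) \prod_(O in orbits A m | covered O B) (1 - orbit_weight A O)^-1 ^ w.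
    rewrite orbit_prod_restrict_mx -prodfV prod_exprz; apply: eq_bigr => m _.
    by rewrite -prodfV prod_exprz.
  under [RHS]eq_bigr do rewrite orbit_prod_exprz.
  rewrite exchange_big /=; apply: eq_bigr => m _.
  rewrite (exchange_big_dep (fun O => O \in orbits A m)) => [|B O _ /andP[]//] /=.
  rewrite big_mkcondr; apply: eq_bigr => O Om.
  (* The weights may be negative, so exponents add up only on a nonzero base. *)
  have a0 : (1 - orbit_weight A O)^-1 != 0.
    rewrite invr_eq0 subr_eq0; apply/negP => /eqP E.
    by have := orbit_weight_lt1 _ _ _ r0 r1 AC _ _ Om; rewrite -E normr1 ltxx.
  rewrite (eq_bigl (fun B => (B \in fam) && covered O B)) => [|B]; last by rewrite Om.
  rewrite -expfz_sum//.
  (* An orbit covered by no block gets the empty exponent 0, hence the factor 1. *)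
  case: (boolP [exists B in fam, covered O B]) => [/exists_inP eB|nB]; last first.
    rewrite big_pred0 ?expr0z// => B; apply/negP => BO.
    by case/negP: nB; apply/exists_inP; exists B; case/andP: BO.
  case/imsetP: Om eB => t _ -> eB.
  (* Covering becomes inclusion of the vertex set, the form used by [sum_block_weight]. *)
  have cE B : covered (orbit_of t) B = ([set i in val t] \subset B).
    rewrite covered_orbit_of; apply/allP/fintype.subsetP => h i; first by rewrite inE => /h.
    by move=> it; apply: h; rewrite inE.
  rewrite (eq_bigl (fun B => (B \in fam) && ([set i in val t] \subset B))) => [|B];
    last by rewrite cE.
  rewrite sum_block_weight ?expr1z//.
  by case: eB => B Bf; rewrite cE; exists B.
rewrite (funext partialE).
(* The product over blocks is finite, so the limit is taken block by block; a nonzero determinant is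
   what negative exponents require. *)
apply: cvg_big => [|B Bf]; first exact: mul_continuous.
rewrite -det_restrict_mx.
have cv := orbit_prod_inv_cvg _ _ _ r0 r1 (BC B).
by apply: cvg_exprz; rewrite // invr_eq0 (det_1sub_neq0 _ _ _ r0 r1 (BC B)).
Qed.
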